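(* Let $t \ge k \ge 3$ be integers. Then $$\left\lfloor \frac{t}{2} \right\rfloor \left\lfloor \frac{t-1}{2(k-2)} \right\rfloor < r_k(F^k, t) \le t(t-1)+1.$$
   Context: A $k$-graph is a family of $k$-element subsets (edges) of a finite vertex set; a set of vertices is independent if it contains no edge. The $k$-Fan $F^k$ is the $k$-graph consisting of $k+1$ edges $E_1,\dots,E_k,E$ such that $E_i \cap E_j = \{v\}$ for all $1 \le i < j \le k$, where $v \notin E$, and $|E_i \cap E| = 1$ for $1 \le i \le k$. For a $k$-graph $\mathcal{F}$, the Ramsey number $r_k(\mathcal{F},t)$ is the smallest integer $n$ such that every $\mathcal{F}$-free $k$-graph on $n$ vertices has an independent set of size at least $t$. *)

(* Defs.v *)
From mathcomp Require Import all_boot.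

Set Implicit Arguments.
Unset Strict Implicit.
Unset Printing Implicit Defensive.

Definition kgraph (k : nat) (T : finType) (G : {set {set T}}) : Prop :=
  forall e, e \in G -> #|e| = k.

Definition independent (T : finType) (G : {set {set T}}) (S : {set T}) : Prop :=
  forall e, e \in G -> ~~ (e \subset S).

(* [F] is identified with its family of edges, so a copy only has to be       *)
(* injective on the vertices covered by edges: isolated points of the ambient *)
(* type [V] are not vertices of [F].                                          *)
Definition contains_copy (V T : finType)
    (F : {set {set V}}) (G : {set {set T}}) : Prop :=
  exists2 f : V -> T, {in cover F &, injective f} &
    forall e, e \in F -> f @: e \in G.

Definition free (V T : finType) (F : {set {set V}}) (G : {set {set T}}) : Prop :=
  ~ contains_copy F G.

(* The conditions determine [F] up to isomorphism when [1 < k]; in particular *)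
(* they force the [k.+1] listed edges to be distinct.                         *)
Definition is_fan (k : nat) (V : finType) (F : {set {set V}}) : Prop :=
  kgraph k F /\
  exists (v : V) (E_ : 'I_k -> {set V}) (E : {set V}),
    [/\ F = E |: [set E_ i | i : 'I_k],
        forall i j : 'I_k, i != j -> E_ i :&: E_ j = [set v],
        v \notin E
      & forall i : 'I_k, #|E_ i :&: E| = 1].

Definition ramsey_property (k : nat) (V : finType) (F : {set {set V}})
    (t n : nat) : Prop :=
  forall (T : finType) (G : {set {set T}}),
    #|T| = n -> kgraph k G -> free F G ->
    exists2 S : {set T}, independent G S & t <= #|S|.

(* [r] is the Ramsey number r_k(F, t); such an [r] is unique if it exists. *)
Definition is_ramsey_number (k : nat) (V : finType) (F : {set {set V}})
    (t r : nat) : Prop :=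
  ramsey_property k F t r /\ forall n, ramsey_property k F t n -> r <= n.

Lemma is_ramsey_number_uniq (k : nat) (V : finType) (F : {set {set V}})
    (t r s : nat) :
  is_ramsey_number k F t r -> is_ramsey_number k F t s -> r = s.
Proof.
move=> [Pr minr] [Ps mins]; apply/eqP.
by rewrite eqn_leq (minr _ Ps) (mins _ Pr).
Qed.

Lemma is_fan_exists (k : nat) : 1 < k ->
  exists (V : finType) (F : {set {set V}}), is_fan k F.
Proof.
case: k => [|[|m]] // _.
pose V : finType := option ('I_m.+2 * 'I_m.+1).
pose p (i : 'I_m.+2) (j : 'I_m.+1) : V := Some (i, j).
pose E_ (i : 'I_m.+2) : {set V} := None |: [set p i j | j : 'I_m.+1].
pose E : {set V} := [set p i ord0 | i : 'I_m.+2].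
have NE i : None \notin [set p i j | j : 'I_m.+1] by apply/imsetP => -[].
exists V, (E |: [set E_ i | i : 'I_m.+2]); split.
  move=> e; rewrite in_setU1 => /orP [/eqP -> | /imsetP [i _ ->]].
    by rewrite card_imset ?card_ord // => i j [].
  by rewrite cardsU1 NE card_imset ?card_ord // => a b [].
exists None, E_, E; split => //.
- move=> i j nij; apply/setP => -[[a b]|]; rewrite !inE //=.
  apply/negP => /andP [/imsetP [x _ [ai _]] /imsetP [y _ [aj _]]].
  by rewrite -ai -aj eqxx in nij.
- by apply/imsetP => -[].
- move=> i; apply/eqP/cards1P; exists (p i ord0).
  apply/setP => x; rewrite !inE; apply/idP/eqP.
    case/andP => xi /imsetP [a _ xa]; rewrite {}xa in xi *.
    by case/orP: xi => [/eqP // | /imsetP [b _ [-> _]]].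
  by move=> ->; apply/andP; split; [apply/orP; right|]; apply: imset_f.
Qed.

(* Main.v *)
Require Import Defs.
From mathcomp Require Import all_boot zify.
From Stdlib Require Import Classical.

Set Implicit Arguments.
Unset Strict Implicit.
Unset Printing Implicit Defensive.

(** For the upper bound, colour the vertices greedily with [t] colours. If this
    never gets stuck, some colour class of the [t * (t - 1) + 1] vertices has at
    least [t] elements and is independent. If it gets stuck at [v], there are
    [t] edges meeting pairwise exactly in [v]; one further vertex from each of
    them gives a [t]-set, and an edge inside it would complete a fan.

    For the lower bound, take as edges the hooks of an [a * b] grid: a corner, a
    point to its right in the same row, and [k - 2] points below it in its
    column. If an edge of the graph has points [p] and [q] with [p] strictly to
    the left of [q], its corner is in the row of [q] and the column of [p]. So
    among the three edges of a fan that join its center to the corner, the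
    right point and a lower point of the crossing hook, either two share a point
    other than the center or one meets that hook twice. *)

(** * Least elements, pigeonhole, and passing to more vertices *)

Lemma exists_least (P : nat -> Prop) n :
  P n -> exists2 r, P r & forall m, P m -> r <= m.
Proof.
elim/ltn_ind: n => n IHn Pn.
(* [P] will be [ramsey_property], which quantifies over all finite types, so the case split needs
   excluded middle. *)
case: (classic (exists2 m, P m & m < n)) => [[m Pm ltmn] | noP].
  exact: IHn Pm.
exists n => // m Pm; rewrite leqNgt; apply/negP => ltmn.
by apply: noP; exists m.
Qed.

Lemma pigeonhole (T I : finType) (A : {set T}) (f : T -> I) n :
  n * #|I| < #|A| -> exists i, n < #|[set x in A | f x == i]|.
Proof.
move=> ltnA; apply/existsP; move: ltnA; apply: contraLR.
rewrite negb_exists -leqNgt => /forallP le_n.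
rewrite -sum1_card (partition_big f xpredT) //=.
apply: (@leq_trans (\sum_(i : I) n)); last by rewrite sum_nat_const mulnC.
apply: leq_sum => i _; rewrite sum1_card.
move: (le_n i); rewrite -leqNgt; apply: leq_trans.
by apply: eq_leq; apply: eq_card => x; rewrite !inE.
Qed.

Lemma subset_of_card (T : finType) (A : {set T}) n :
  n <= #|A| -> exists2 B : {set T}, B \subset A & #|B| = n.
Proof.
move=> lenA; have : 0 < #|[set B : {set T} | B \subset A & #|B| == n]|.
  by rewrite cards_draws bin_gt0.
by case/card_gt0P=> B; rewrite inE => /andP [sBA /eqP cB]; exists B.
Qed.

(** Restrict the graph to [n] of its [m] vertices: independent sets of the induced graph stay
    independent. Hence failure at one [n] bounds the Ramsey number from below. *)
Lemma ramsey_property_leq k (V : finType) (F : {set {set V}}) t n m :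
  n <= m -> ramsey_property k F t n -> ramsey_property k F t m.
Proof.
move=> lenm Pn T G cT kG frG.
have [A _ cA] : exists2 A : {set T}, A \subset setT & #|A| = n.
  by apply: subset_of_card; rewrite cardsT cT.
pose U : finType := {x : T | x \in A}.
pose H : {set {set U}} := [set e : {set U} | val @: e \in G].
have [|||S indS leS] := Pn U H.
- by rewrite card_sig cA.
- by move=> e; rewrite inE => /kG; rewrite card_imset //; apply: val_inj.
- case=> f injf fG; apply: frG; exists (fun x => val (f x)).
    by move=> x y xF yF /val_inj; apply: injf.
  by move=> e /fG; rewrite inE -imset_comp.
exists (val @: S); last by rewrite card_imset //; apply: val_inj.
move=> e eG; apply/negP => sub.
have defe : val @: ((val : U -> T) @^-1: e) = e.
  apply/setP => x; apply/imsetP/idP => [[u]|xe]; first by rewrite inE => ? ->.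
  by have /imsetP [u _ defx] := subsetP sub x xe; exists u; rewrite // inE -defx.
have /indS/negP : (val : U -> T) @^-1: e \in H by rewrite inE defe.
apply; apply/subsetP => u; rewrite inE => /(subsetP sub).
by case/imsetP=> w wS /val_inj ->.
Qed.

(** * Fans and their copies *)

Definition fan (k : nat) (T : finType) (v : T) (E_ : 'I_k -> {set T})
    (E : {set T}) : Prop :=
  [/\ forall i j, i != j -> E_ i :&: E_ j = [set v],
      v \notin E & forall i, #|E_ i :&: E| = 1].

Section Fan.

Variables (k : nat) (T : finType) (v : T) (E_ : 'I_k -> {set T}) (E : {set T}).
Hypotheses (k_gt1 : 1 < k) (cardE : #|E| = k) (fanE : fan v E_ E).

Lemma fan_center i : v \in E_ i.
Proof.
have [j nij] : exists j : 'I_k, i != j.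
  have : 1 < #|'I_k| by rewrite card_ord.
  case/card_gt1P => a [b [_ _ nab]]; case: (eqVneq i a) => [->|nia].
    by exists b.
  by exists a.
by have [/(_ _ _ nij)/setP/(_ v)] := fanE; rewrite !inE eqxx => /andP [].
Qed.

Lemma fan_index i j u : u \in E_ i -> u \in E_ j -> u != v -> i = j.
Proof.
move=> ui uj nuv; apply/eqP; apply: contraNT nuv => nij.
by have [/(_ _ _ nij)/setP/(_ u)] := fanE; rewrite !inE ui uj => <-.
Qed.

(** The [k] intersection points are distinct, as different [E_ i] share only [v], which is not in
    [E]; so they exhaust the [k] vertices of [E]. *)
Lemma fan_tips : exists w : 'I_k -> T,
  [/\ injective w, E = [set w i | i : 'I_k] &
      forall i, E_ i :&: E = [set w i]].
Proof.
have [_ nvE card1] := fanE.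
have /fin_all_exists [w defw] : forall i, exists u, E_ i :&: E = [set u].
  by move=> i; apply/cards1P; rewrite card1.
have wP i : w i \in E_ i /\ w i \in E.
  by apply/andP; rewrite -in_setI defw set11.
have injw : injective w.
  move=> i j eqw; apply: (@fan_index i j (w i)); first by case: (wP i).
    by rewrite eqw; case: (wP j).
  by apply: contraNneq nvE => <-; case: (wP i).
exists w; split => //; apply/esym/eqP.
rewrite eqEcard cardE card_imset // card_ord leqnn andbT.
by apply/subsetP => _ /imsetP [i _ ->]; case: (wP i).
Qed.

Lemma fan_cross u : u \in E -> exists2 i, u \in E_ i &
  forall u', u' \in E -> u' \in E_ i -> u' = u.
Proof.
have [w [injw defE wP]] := fan_tips.
rewrite {1}defE => /imsetP [i _ ->]; exists i.
  by have /setP/(_ (w i)) := wP i; rewrite !inE eqxx => /andP [].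
move=> u' u'E u'i; have /setP/(_ u') := wP i.
by rewrite !inE u'E u'i /= => /esym/eqP.
Qed.

End Fan.

(** Any two fans are isomorphic: list each edge through the center as center, point of [E],
    remaining vertices, and match the lists position by position. *)
Lemma fan_copy k (V T : finType) (v : V) (E_ : 'I_k -> {set V}) (E : {set V})
    (v' : T) (E'_ : 'I_k -> {set T}) (E' : {set T}) :
  1 < k -> #|E| = k -> (forall i, #|E_ i| = k) -> fan v E_ E ->
  #|E'| = k -> (forall i, #|E'_ i| = k) -> fan v' E'_ E' ->
  exists f : V -> T,
    [/\ {in \bigcup_i E_ i &, injective f}, forall i, f @: E_ i = E'_ i &
        f @: E = E'].
Proof.
move=> k1 cE cE_ fE cE' cE'_ fE'.
have [w [injw defE wP]] := fan_tips cE fE.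
have [w' [injw' defE' wP']] := fan_tips cE' fE'.
have vE := fan_center k1 fE; have vE' := fan_center k1 fE'.
have wI i : w i \in E_ i /\ w i \in E.
  by apply/andP; rewrite -in_setI wP set11.
have wI' i : w' i \in E'_ i /\ w' i \in E'.
  by apply/andP; rewrite -in_setI wP' set11.
have nwv i : w i != v.
  by have [_ nv _] := fE; apply: contraNneq nv => <-; case: (wI i).
have nwv' i : w' i != v'.
  by have [_ nv _] := fE'; apply: contraNneq nv => <-; case: (wI' i).
pose s i := v :: w i :: enum (E_ i :\ v :\ w i).
pose s' i := v' :: w' i :: enum (E'_ i :\ v' :\ w' i).
have mem_s i : s i =i E_ i.
  move=> u; rewrite !inE mem_enum !inE.
  case: (eqVneq u v) => [->|_] /=; first by rewrite vE.
  by case: (eqVneq u (w i)) => [->|_] //=; case: (wI i).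
have mem_s' i : s' i =i E'_ i.
  move=> u; rewrite !inE mem_enum !inE.
  case: (eqVneq u v') => [->|_] /=; first by rewrite vE'.
  by case: (eqVneq u (w' i)) => [->|_] //=; case: (wI' i).
have uniq_s i : uniq (s i).
  by rewrite /= !inE !mem_enum !inE enum_uniq !eqxx (eq_sym v) (negPf (nwv i)) /= ?andbF.
have uniq_s' i : uniq (s' i).
  by rewrite /= !inE !mem_enum !inE enum_uniq !eqxx (eq_sym v') (negPf (nwv' i)) /= ?andbF.
have size_s i : size (s i) = k.
  by rewrite -(card_uniqP (uniq_s i)) (eq_card (mem_s i)).
have size_s' i : size (s' i) = k.
  by rewrite -(card_uniqP (uniq_s' i)) (eq_card (mem_s' i)).
pose g i u := nth v' (s' i) (index u (s i)).
(* All [g i] send [v] to [v'], so the choice of [i] is immaterial; the value [v'] outside the [E_ i]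
   is a dummy. *)
pose f u := if [pick i | u \in E_ i] is Some i then g i u else v'.
have gv i : g i v = v' by rewrite /g /= eqxx.
have gw i : g i (w i) = w' i by rewrite /g /= eq_sym (negPf (nwv i)) eqxx.
have fE_ i u : u \in E_ i -> f u = g i u.
  move=> ui; rewrite /f; case: pickP => [j uj|/(_ i)]; last by rewrite ui.
  have [->|nuv] := eqVneq u v; first by rewrite !gv.
  by rewrite (fan_index fE uj ui nuv).
have gE i u : u \in E_ i -> g i u \in E'_ i.
  move=> ui; rewrite -mem_s' mem_nth // size_s' -(size_s i) index_mem.
  by rewrite mem_s.
have injg i : {in E_ i &, injective (g i)}.
  move=> u u' ui u'i /eqP.
  rewrite nth_uniq ?uniq_s' ?size_s' -?(size_s i) ?index_mem ?mem_s // => /eqP.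
  by apply: (index_inj v); rewrite mem_s.
have img i : f @: E_ i = E'_ i.
  apply/eqP; rewrite eqEcard; apply/andP; split.
    by apply/subsetP => _ /imsetP [u ui ->]; rewrite (fE_ i) ?gE.
  rewrite card_in_imset ?cE_ ?cE'_ // => a b ai bi.
  by rewrite !(fE_ i) //; apply: injg.
exists f; split => //.
  move=> a b /bigcupP [i _ ai] /bigcupP [j _ bj] eqf.
  have [eqij|nij] := eqVneq i j.
    by subst j; move: eqf; rewrite !(fE_ i) //; apply: injg.
  (* The common image lies in [E'_ i] and [E'_ j], which meet only in [v']. *)
  have fav : f a = v'.
    have [/(_ _ _ nij)/setP/(_ (f a)) + _ _] := fE'.
    rewrite !inE {2}eqf !(fE_ _ _ ai) (fE_ _ _ bj) !gE //=.
    by move/esym/eqP.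
  have a_v : a = v.
    by apply: (injg i) => //; rewrite gv -(fE_ i).
  have b_v : b = v.
    by apply: (injg j) => //; rewrite gv -(fE_ j) // -eqf.
  by rewrite a_v b_v.
rewrite defE defE' -imset_comp; apply: eq_imset => i /=.
by rewrite (fE_ i) ?gw //; case: (wI i).
Qed.

(** Since fans are unique up to isomorphism, a copy of [F] can be sought directly among the edges of
    [G]. *)
Lemma contains_fanP k (V T : finType) (F : {set {set V}}) (G : {set {set T}}) :
  1 < k -> is_fan k F -> kgraph k G ->
  contains_copy F G <->
  exists v E_ E, [/\ @fan k T v E_ E, forall i, E_ i \in G & E \in G].
Proof.
move=> k1 [kF [v [E_ [E [defF disj nvE one]]]]] kG.
have EF : E \in F by rewrite defF setU11.
have E_F i : E_ i \in F by rewrite defF inE imset_f ?orbT.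
have fanF : fan v E_ E by split.
have inF e x : e \in F -> x \in e -> x \in cover F.
  by move=> eF xe; apply/bigcupP; exists e.
have vF i := fan_center k1 fanF i.
have i0 : 'I_k by apply: (Ordinal (ltnW k1)).
split=> [[f injf fG]|[v' [E'_ [E' [fan' E'_G E'G]]]]].
  have imI A B : A \in F -> B \in F -> f @: A :&: f @: B = f @: (A :&: B).
    move=> AF BF; rewrite imsetI // => a b aA bB.
    by apply: injf; [apply: inF AF _ | apply: inF BF _].
  exists (f v), (fun i => f @: E_ i), (f @: E); split => //; last first.
  - exact: fG.
  - by move=> i; apply: fG.
  split=> [i j nij||i].
  - by rewrite imI // disj // imset_set1.
  - apply: contra nvE => /imsetP [u uE eqf].
    by rewrite (injf v u) //; [apply: inF (E_F i0) _ | apply: inF EF _].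
  - rewrite imI // card_in_imset // => a b; rewrite !inE => /andP [_ aE] /andP [_ bE].
    by apply: injf; apply: inF EF _.
have [f [injf fE_ fE]] := fan_copy k1 (kF _ EF) (fun i => kF _ (E_F i)) fanF
  (kG _ E'G) (fun i => kG _ (E'_G i)) fan'.
exists f; last first.
  by move=> e; rewrite defF => /setU1P [->|/imsetP [i _ ->]]; rewrite ?fE ?fE_.
(* The vertices of [E] all lie on some [E_ i], so injectivity on the union of the [E_ i]
   suffices. *)
have covF x : x \in cover F -> x \in \bigcup_i E_ i.
  case/bigcupP => e; rewrite defF => /setU1P [->|/imsetP [i _ ->]] xe; last first.
    by apply/bigcupP; exists i.
  have [i xi _] := fan_cross (kF _ EF) fanF xe.
  by apply/bigcupP; exists i.
by move=> a b /covF aF /covF bF; apply: injf.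
Qed.

(** * The upper bound *)

(* Greedy colouring: a vertex that can take none of the [t] colours lies in an
   edge for each colour whose other vertices all have that colour, and these
   [t] edges form a sunflower. *)
Lemma coloring_or_sunflower (T : finType) (G : {set {set T}}) t (A : {set T}) :
  0 < t ->
  (exists c : T -> 'I_t, forall e i, e \in G -> e \subset A ->
     e != set0 -> ~~ (e \subset [set x | c x == i])) \/
  (exists (v : T) (E_ : 'I_t -> {set T}), forall i,
     [/\ E_ i \in G, v \in E_ i & forall j, i != j -> E_ i :&: E_ j = [set v]]).
Proof.
move=> t0; elim: {A}_.+1 {-2}A (ltnSn #|A|) => // n IHn A leAn.
have [->|[x xA]] := set_0Vmem A.
  by left; exists (fun _ => Ordinal t0) => e i _; rewrite subset0 => ->.
have [|[c cP]|] := IHn (A :\ x); last by right.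
  by rewrite (cardsD1 x) xA in leAn.
(* A bad [e] is an edge that forbids giving colour [i] to [x]. *)
pose bad i e := [&& e \in G, x \in e, e \subset A &
                    e :\ x \subset [set y | c y == i]].
have [/forallP allbad|] := boolP [forall i, [exists e, bad i e]].
  right; have /fin_all_exists [E_ EP] : forall i, exists e, bad i e.
    by move=> i; apply/existsP.
  exists x, E_ => i; have /and4P [eG xe _ ci] := EP i; split => // j nij.
  have /and4P [_ xj _ cj] := EP j.
  apply/setP => y; rewrite !inE; have [->|nyx] := eqVneq y x; first by rewrite xe.
  apply/negP => /andP [yi yj]; case/negP: nij; apply/eqP.
  have /(subsetP ci) : y \in E_ i :\ x by rewrite !inE nyx.
  have /(subsetP cj) : y \in E_ j :\ x by rewrite !inE nyx.
  by rewrite !inE => /eqP -> /eqP.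
rewrite negb_forall => /existsP [i0]; rewrite negb_exists => /forallP good.
left; exists (fun y => if y == x then i0 else c y) => e i eG eA e0.
have [xe|nxe] := boolP (x \in e); last first.
  have: ~~ (e \subset [set y | c y == i]).
    by apply: cP => //; rewrite subsetD1 eA.
  apply: contra => /subsetP sub; apply/subsetP => y ye.
  by move: (sub y ye); rewrite !inE; case: (eqVneq y x) => // eyx; rewrite -eyx ye in nxe.
apply/negP => /subsetP sub; case/negP: (good e).
have eqi : i0 = i by have := sub x xe; rewrite inE eqxx => /eqP.
rewrite /bad eG xe eA; apply/subsetP => y; rewrite !inE => /andP [nyx ye].
by have := sub y ye; rewrite inE (negPf nyx) eqi.
Qed.

Lemma sunflower_independent_or_fan k t (T : finType) (G : {set {set T}})
    (v : T) (E_ : 'I_t -> {set T}) :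
  1 < k -> kgraph k G ->
  (forall i, [/\ E_ i \in G, v \in E_ i &
     forall j, i != j -> E_ i :&: E_ j = [set v]]) ->
  (exists2 S : {set T}, independent G S & t <= #|S|) \/
  (exists v' E'_ E', [/\ @fan k T v' E'_ E', forall i, E'_ i \in G & E' \in G]).
Proof.
move=> k1 kG sun.
have /fin_all_exists [x xP] : forall i, exists u, (u \in E_ i) && (u != v).
  move=> i; have [eG ve _] := sun i.
  have : 0 < #|E_ i :\ v|.
    by have := kG _ eG; rewrite (cardsD1 v) ve; lia.
  by case/card_gt0P => u; rewrite !inE andbC => ?; exists u.
have idx i j : x i \in E_ j -> i = j.
  move=> xj; have /andP [xi nxv] := xP i.
  apply/eqP; apply: contraNT nxv => nij; have [_ _ /(_ j nij)] := sun i.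
  by move/setP/(_ (x i)); rewrite !inE xi xj => <-.
have injx : injective x.
  by move=> i j eqx; apply: idx; rewrite eqx; case/andP: (xP j).
pose X := [set x i | i : 'I_t].
have cX : #|X| = t by rewrite card_imset // card_ord.
have [/forallP ind|] := boolP [forall e in G, ~~ (e \subset X)].
  left; exists X; last by rewrite cX.
  by move=> e eG; have := ind e; rewrite eG.
rewrite negb_forall => /existsP [E]; rewrite negb_imply negbK => /andP [EG sEX].
(* [E] consists of chosen vertices, so it singles out the [k] petals in [J]; these become the edges
   of the fan through [v]. *)
right; pose J := [set i | x i \in E].
have defE : E = x @: J.
  apply/setP => u; apply/idP/imsetP => [uE|[i]]; last by rewrite inE => ? ->.
  have /imsetP [i _ defu] := subsetP sEX u uE; exists i => //.
  by rewrite inE -defu.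
have cJ : #|J| = k by rewrite -(card_imset _ injx) -defE kG.
pose h (i : 'I_k) := enum_val (cast_ord (esym cJ) i).
have hJ i : x (h i) \in E by have := enum_valP (cast_ord (esym cJ) i); rewrite inE.
have injh : injective h by move=> i j /enum_val_inj/cast_ord_inj.
exists v, (fun i => E_ (h i)), E; split => //; last by move=> i; case: (sun (h i)).
split=> [i j nij||i].
- by have [_ _ ->] := sun (h i); rewrite ?(inj_eq injh).
- apply/negP; rewrite defE => /imsetP [i _ defv].
  by have := xP i; rewrite -defv eqxx andbF.
- apply/eqP/cards1P; exists (x (h i)); apply/setP => u; rewrite !inE.
  apply/andP/eqP => [[ui]|->]; last by rewrite hJ; case/andP: (xP (h i)).
  by rewrite defE => /imsetP [j _ defu]; rewrite defu in ui *; rewrite (idx _ _ ui).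
Qed.

Lemma fan_ramsey_upper k t (V : finType) (F : {set {set V}}) :
  1 < k -> 0 < t -> is_fan k F -> ramsey_property k F t (t * (t - 1) + 1).
Proof.
move=> k1 t0 fF T G cT kG frG.
case: (@coloring_or_sunflower T G t setT t0) => [[c cP]|[v [E_ sun]]]; last first.
  case: (sunflower_independent_or_fan k1 kG sun) => // fan'.
  by case: frG; apply/(contains_fanP k1 fF kG).
(* Classes of at most [t - 1] vertices would cover only [t * (t - 1)] vertices. *)
have [|i] := @pigeonhole T 'I_t setT c (t - 1).
  by rewrite cardsT cT card_ord; lia.
move=> lti; exists [set x in setT | c x == i]; last by apply: leq_trans lti; lia.
move=> e eG; have := cP e i eG (subsetT _).
have -> : [set x in setT | c x == i] = [set x | c x == i].
  by apply/setP => x; rewrite !inE.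
by apply; rewrite -card_gt0 kG //; lia.
Qed.

(** * The fan-free graph of hooks in a grid *)

Section Hooks.

Variables (k a b : nat).
Implicit Types (x y z p q : 'I_a * 'I_b).

(* A grid point is a pair (row, column); a hook consists of its corner [x], one
   point [y] to the right of [x] in the same row, and points of the column of
   [x] in later rows. *)
Definition hook x y (e : {set 'I_a * 'I_b}) :=
  [&& x \in e, y \in e, x.1 == y.1, x.2 < y.2 &
      [forall (z | z \in e), (z == y) || ((z.2 == x.2) && (x.1 <= z.1))]].

Definition hook_graph : {set {set 'I_a * 'I_b}} :=
  [set e : {set 'I_a * 'I_b} | (#|e| == k) && [exists x, exists y, hook x y e]].

Lemma hook_graph_uniform : kgraph k hook_graph.
Proof. by move=> e; rewrite inE => /andP [/eqP]. Qed.

Lemma grid_eq p q : p.1 = q.1 :> nat -> p.2 = q.2 :> nat -> p = q.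
Proof. by case: p q => [i j] [i' j'] /= /val_inj -> /val_inj ->. Qed.

(** Only the right point of a hook leaves the column of the corner, so [q] is that point and [p]
    lies in the column, no higher than the corner. *)
Lemma hook_corner p q (e : {set 'I_a * 'I_b}) : e \in hook_graph -> p \in e -> q \in e ->
  p.2 < q.2 -> ((q.1, p.2) \in e) && (q.1 <= p.1).
Proof.
rewrite inE => /andP [_ /existsP [x /existsP [y]]].
case/and5P => xe ye /eqP exy lxy /forallP H pe qe ltpq.
have := H p; have := H q; rewrite pe qe /=.
case: (eqVneq q y) => [eq _|_ /= /andP [/eqP eq _]]; last first.
  rewrite eq in ltpq; case: (eqVneq p y) => [ep _|_ /= /andP [/eqP ep _]].
    by rewrite ep in ltpq; lia.
  by rewrite ep ltnn in ltpq.
case: (eqVneq p y) => [ep _|_ /= /andP [/eqP -> lep]].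
  by rewrite ep eq ltnn in ltpq.
by rewrite eq -exy -surjective_pairing xe.
Qed.

Lemma hook_graph_fan_free v (E_ : 'I_k -> {set 'I_a * 'I_b}) E :
  2 < k -> fan v E_ E -> (forall i, E_ i \in hook_graph) -> E \notin hook_graph.
Proof.
move=> k2 fanE E_G; apply/negP => EG; have k1 := ltnW k2.
have cE := hook_graph_uniform EG.
have vC := fan_center k1 fanE.
have vE : v \notin E by case: fanE.
have := EG; rewrite inE => /andP [_ /existsP [x /existsP [y]]].
case/and5P => xE yE /eqP exy lxy /forallP EP.
(* As [k] is at least 3, the crossing hook has a point below its corner. *)
have [z zE [zc ltxz]] : exists2 z, z \in E & z.2 = x.2 /\ x.1 < z.1.
  have : 0 < #|E :\ x :\ y|.
    have := cE; rewrite (cardsD1 x) xE (cardsD1 y (E :\ x)).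
    by case: #|_| => //; case: (y \in _) => /=; lia.
  case/card_gt0P => z; rewrite !inE => /and3P [nzy nzx zE]; exists z => //.
  have := EP z; rewrite zE (negPf nzy) => /andP [/eqP ec le]; split=> //.
  rewrite ltn_neqAle le andbT; apply: contraNneq nzx => er.
  by apply/eqP/grid_eq => //; rewrite ec.
have [ix xi _] := fan_cross cE fanE xE.
have [iy yi yU] := fan_cross cE fanE yE.
have [iz zi zU] := fan_cross cE fanE zE.
have nxy : x \notin E_ iy.
  by apply/negP => /(yU x xE) eq; rewrite eq in lxy; lia.
have nxz : x \notin E_ iz.
  by apply/negP => /(zU x xE) eq; rewrite eq in ltxz; lia.
have [ltvc|ltcv|/val_inj eqvc] := ltngtP v.2 x.2.
(* Center left of [x]: the edges through [x] and [y] share [(x.1, v.2)]. This is not [v], since the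
   edge through [z] forces [v] to be at least as low as [z]. *)
- have /andP [cx _] := hook_corner (E_G ix) (vC ix) xi ltvc.
  have /andP [cy _] := hook_corner (E_G iy) (vC iy) yi (ltn_trans ltvc lxy).
  have /andP [_ lezv] : ((z.1, v.2) \in E_ iz) && (z.1 <= v.1).
    by apply: hook_corner => //; rewrite zc.
  rewrite -exy in cy; have [ev|nv] := eqVneq (x.1, v.2) v.
    by move: ltxz lezv; rewrite -ev /=; lia.
  by rewrite (fan_index fanE cx cy nv) in xi; rewrite xi in nxy.
(* Center right of [x]: the edges through [x] and [z] share [(v.1, x.2)], which is in another column
   than [v]. *)
- have /andP [cx _] := hook_corner (E_G ix) xi (vC ix) ltcv.
  have /andP [cz _] : ((v.1, z.2) \in E_ iz) && (v.1 <= z.1).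
    by apply: hook_corner => //; rewrite zc.
  rewrite zc in cz; have nv : (v.1, x.2) != v.
    by apply/eqP => ev; rewrite -ev /= in ltcv; lia.
  by rewrite (fan_index fanE cx cz nv) in xi; rewrite xi in nxz.
(* Center in the column of [x]: the edge through [y] also contains [x], so it meets [E] twice. *)
- have /andP [cy _] : ((y.1, v.2) \in E_ iy) && (y.1 <= v.1).
    by apply: hook_corner => //; rewrite eqvc.
  by rewrite -exy eqvc -surjective_pairing (negPf nxy) in cy.
Qed.

(* Delete the last [k - 2] points of [S] in every column: among the more than
   [a] points left, two share a row, and the left one is the corner of a hook. *)
Lemma hook_graph_not_independent (S : {set 'I_a * 'I_b}) :
  1 < k -> a + (k - 2) * b < #|S| -> ~ independent hook_graph S.
Proof.
move=> k1 ltS ind.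
pose below p := [set q in S | (q.2 == p.2) && (p.1 < q.1)].
pose L := [set p in S | #|below p| < k - 2].
have leL : #|L| <= (k - 2) * b.
  rewrite leqNgt; apply/negP => ltL.
  have [|j] := @pigeonhole _ 'I_b L snd (k - 2); first by rewrite card_ord.
  set Lj := [set x in L | _] => ltLj.
  have [p0 p0L] : exists p, p \in Lj.
    by apply/card_gt0P; apply: leq_trans ltLj.
  (* The topmost point of [Lj] has the others, at least [k - 2] of them, below it, contrary to its
     membership in [L]. *)
  case: (arg_minnP (fun p : 'I_a * 'I_b => p.1 : nat) p0L) => p pL pmin.
  have {}pL : p \in Lj by [].
  have := pL; rewrite !inE => /andP [/andP [pS ltp] /eqP pj].
  have : #|Lj :\ p| <= #|below p|.
    apply: subset_leq_card; apply/subsetP => q; rewrite in_setD1 => /andP [nqp qL].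
    have := pmin q qL; have := qL; rewrite !inE pj => /andP [/andP [-> _] /eqP qj].
    rewrite qj eqxx /= leq_eqVlt => /orP [/eqP epq|//].
    by case/eqP: nqp; apply: grid_eq => //; rewrite qj pj.
  move=> le; rewrite (cardsD1 p) pL add1n ltnS in ltLj.
  by rewrite ltnNge (leq_trans ltLj le) in ltp.
have [|i] := @pigeonhole _ 'I_a (S :\: L) fst 1.
  have sLS : L \subset S by apply/subsetP => p; rewrite inE => /andP [].
  by rewrite card_ord cardsDS //; lia.
case/card_gt1P => x [y [xP yP nxy]].
have {xP yP nxy} [{}x [{}y [xS ltx yS exy lxy]]] : exists x y,
    [/\ x \in S, k - 2 <= #|below x|, y \in S, x.1 = y.1 & x.2 < y.2].
  move: xP yP; rewrite !inE => /andP [/andP [nx xS] /eqP xi] /andP [/andP [ny yS] /eqP yi].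
  rewrite xS -leqNgt in nx; rewrite yS -leqNgt in ny.
  have [lt|lt|eq] := ltngtP x.2 y.2.
  - by exists x, y; split; rewrite ?xi ?yi.
  - by exists y, x; split; rewrite ?xi ?yi.
  - by case/eqP: nxy; apply: grid_eq; rewrite ?xi ?yi.
(* Any [k - 2] points of [S] below [x] complete [x] and [y] to a hook of size [k]. *)
have [B sB cB] := subset_of_card ltx.
have BP z : z \in B -> [/\ z \in S, z.2 = x.2 & x.1 < z.1].
  by move/(subsetP sB); rewrite !inE => /and3P [? /eqP ? ?].
have yB : y \notin B.
  by apply/negP => /BP [_ eq _]; rewrite eq in lxy; lia.
have xyB : x \notin y |: B.
  rewrite !inE negb_or; apply/andP; split.
    by apply/eqP => eq; rewrite eq in lxy; lia.
  by apply/negP => /BP [_ _]; lia.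
have /ind/negP : x |: (y |: B) \in hook_graph.
  rewrite inE !cardsU1 xyB yB cB; apply/andP; split; first by apply/eqP; lia.
  apply/existsP; exists x; apply/existsP; exists y.
  rewrite /hook !inE !eqxx /= orbT exy eqxx lxy /=.
  apply/forallP => z; apply/implyP; rewrite !inE => /or3P [/eqP->|->|/BP [_ -> lt]] //.
    by rewrite eqxx exy leqnn orbT.
  by rewrite eqxx -exy ltnW ?orbT.
apply; apply/subsetP => z; rewrite !inE => /or3P [/eqP->|/eqP->|/BP []] //.
Qed.

End Hooks.

(** * The lower bound and the theorem *)

Lemma fan_ramsey_lower k t a b (V : finType) (F : {set {set V}}) :
  2 < k -> is_fan k F -> a + (k - 2) * b < t -> ~ ramsey_property k F t (a * b).
Proof.
move=> k2 fF ltt ramsey; have k1 := ltnW k2.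
have kG := @hook_graph_uniform k a b.
have [|||S indS leS] := ramsey ('I_a * 'I_b)%type (hook_graph k a b) => //.
- by rewrite card_prod !card_ord.
- case/(contains_fanP k1 fF kG) => v [E_ [E [fanE E_G]]].
  by rewrite (negPf (hook_graph_fan_free k2 fanE E_G)).
- by apply: hook_graph_not_independent indS => //; apply: leq_trans leS.
Qed.

Theorem theorem1p10 (k t : nat) (hk : 3 <= k) (hkt : k <= t)
    (V : finType) (F : {set {set V}}) (hF : is_fan k F) :
  exists2 r : nat, is_ramsey_number k F t r &
    t %/ 2 * ((t - 1) %/ (2 * (k - 2))) < r <= t * (t - 1) + 1.
Proof.
have upper : ramsey_property k F t (t * (t - 1) + 1).
  by apply: fan_ramsey_upper => //; lia.
have [r ramr minr] := exists_least upper.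
exists r => //; rewrite (minr _ upper) andbT ltnNge; apply/negP => ler.
apply: fan_ramsey_lower (ramsey_property_leq ler ramr) => //.
(* With [a = t %/ 2] rows, [2 * a <= t] and [2 * (k - 2) * b <= t - 1] add up to
   [2 * (a + (k - 2) * b) < 2 * t]. *)
set b := _ %/ (2 * _).
have : b * (2 * (k - 2)) <= t - 1 by apply: leq_divM.
nia.
Qed.
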